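(* Let $\varphi$ be an endomorphism of a subshift $(X,\sigma)$ and $\psi$ an endomorphism of a subshift $(X',\sigma')$. If $\varphi$ and $\psi$ are topologically conjugate, i.e. there is a homeomorphism $\theta:X\to X'$ with $\theta\sigma=\sigma'\theta$ and $\theta\varphi=\psi\theta$, then \[-p_L(\varphi)=-p_L(\psi),\quad p_R(\varphi)=p_R(\psi),\quad -q_R(\varphi)=-q_R(\psi),\quad q_L(\varphi)=q_L(\psi).\]
   Context: **Subshifts.** An alphabet is a finite set with at least two elements. For an alphabet $A$, $A^{\mathbb Z}$ carries the product topology; the shift maps $(a_j)_j$ to $(a_{j+1})_j$. A subshift $(X,\sigma)$ over $A$ is a closed $X\subset A^{\mathbb Z}$ with $\sigma(X)=X$, $\sigma$ being the restricted shift; $L_k(X)$ is the set of words of length $k$ occurring in points of $X$. An endomorphism of $(X,\sigma)$ is a continuous map $\varphi:X\to X$ commuting with $\sigma$ (not assumed onto). **Type.** A local rule of neighborhood-size $N\ge 0$ on $X$ is a map $f:L_{N+1}(X)\to L_1(X)$ with $(f(a_j\dots a_{j+N}))_{j\in\mathbb Z}\in X$ for all $(a_j)\in X$. For $m,n\ge0$, $m+n=N$, $\varphi$ is of $(m,n)$-type given by $f$ if $\varphi((a_j)_j)=(f(a_{j-m}\dots a_{j+n}))_j$. Every endomorphism arises this way. **Degrees.** Let $f$ be a local rule of neighborhood-size $N$. It is $I$ left-redundant ($I\ge0$) if for all $(a_j),(b_j)\in X$, $a_j=b_j$ for all $j\ge0$ implies $f(a_{-I}\dots a_{-I+N})=f(b_{-I}\dots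 b_{-I+N})$; $I$ right-redundant if $a_j=b_j$ for all $j\le0$ implies $f(a_{I-N}\dots a_I)=f(b_{I-N}\dots b_I)$. It is strictly $I$ left-redundant if $I$ left-redundant but not $I+1$ left-redundant, strictly $\infty$ left-redundant if $I$ left-redundant for all $I\ge0$; similarly for right. It is $k$ right-mergible ($k\ge0$) if $a_j=b_j$ for $j\le 0$ and $f(a_{j-N}\dots a_j)=f(b_{j-N}\dots b_j)$ for $1\le j\le k+1$ imply $a_1=b_1$; $k$ left-mergible if $a_j=b_j$ for $j\ge0$ and $f(a_{-j}\dots a_{-j+N})=f(b_{-j}\dots b_{-j+N})$ for $1\le j\le k+1$ imply $a_{-1}=b_{-1}$. It is strictly $k$ right-mergible if $k\ge 0$ is the least integer for which it is $k$ right-mergible, strictly $\infty$ right-mergible if there is none; similarly for left. If $\varphi$ is of $(m,n)$-type given by $f$ which is strictly $I$ left-redundant, strictly $J$ right-redundant, strictly $k$ right-mergible and strictly $l$ left-mergible, then $P_L(\varphi)=I-m$, $P_R(\varphi)=J-n$, and, if $X$ is infinite, $Q_R(\varphi)=n-k$, $Q_L(\varphi)=m-l$; if $X$ is finite, $Q_R(\varphi)=Q_L(\varphi)=\infty$. These are independent of the choice of $f$, $m$, $n$. **Limits.** $p_L(\varphi)=\lim_{s\to\infty}P_L(\varphi^s)/s$, $p_R(\varphi)=\lim_{s\to\infty} P_R(\varphi^s)/s$, $q_R(\varphi)=\lim_{s\to\infty} Q_R(\varphi^s)/s$, $q_L(\varphi)=\lim_{s\to\infty} Q_L(\varphi^s)/s$;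 these limits exist in $\mathbb R\cup\{\pm\infty\}$. *)

(* Defs.v *)
From HB Require Import structures.
From mathcomp Require Import all_boot all_order all_algebra.
From mathcomp Require Import all_classical all_reals all_analysis.

Set Implicit Arguments.
Unset Strict Implicit.
Unset Printing Implicit Defensive.

Import Order.TTheory GRing.Theory Num.Theory.
Local Open Scope classical_set_scope.
Local Open Scope ring_scope.

Notation config A := {ptws int -> discrete_topology A}.

Definition shift (A : finType) (a : config A) : config A := fun j => a (j + 1).

Definition subshift (A : finType) (X : set (config A)) : Prop :=
  closed X /\ @shift A @` X = X.

(* A map X -> X' is represented by a map between the ambient full shifts, of
   which only the restriction to X matters. *)
Definition endomorphism (A : finType) (X : set (config A))
    (phi : config A -> config A) : Prop :=
  [/\ set_fun X X phi, {within X, continuous phi} &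
      forall a, X a -> phi (shift a) = shift (phi a)].

Definition homeomorphism (S T : topologicalType) (X : set S) (Y : set T)
    (theta : S -> T) : Prop :=
  [/\ set_fun X Y theta, {within X, continuous theta} &
      exists theta' : T -> S,
        [/\ set_fun Y X theta', {within Y, continuous theta'},
            {in X, cancel theta theta'} & {in Y, cancel theta' theta}]].

Definition top_conjugate (A A' : finType)
    (X : set (config A)) (phi : config A -> config A)
    (X' : set (config A')) (psi : config A' -> config A') : Prop :=
  exists theta : config A -> config A',
    [/\ homeomorphism X X' theta,
        forall a, X a -> theta (shift a) = shift (theta a) &
        forall a, X a -> theta (phi a) = psi (theta a)].

(* the word a_i a_(i+1) ... a_(i+k-1) *)
Definition word (A : finType) (a : config A) (i : int) (k : nat) : k.-tuple A :=
  [tuple (a (i + t%:Z) : A) | t < k].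

(* the words of length k occurring in points of X *)
Definition language (A : finType) (X : set (config A)) (k : nat) :
    set (k.-tuple A) :=
  [set w | exists2 a, X a & exists i, w = word a i k].
Arguments language {A} X k.

(* A map L_(N+1)(X) -> L_1(X) is represented by a map on all words of length
   N + 1; the values outside L_(N+1)(X) are irrelevant. *)
Definition local_rule (A : finType) (X : set (config A)) (N : nat)
    (f : N.+1.-tuple A -> A) : Prop :=
  (forall w, language X N.+1 w -> language X 1 [tuple f w]) /\
  (forall a, X a -> X (fun j => f (word a j N.+1))).

Definition of_type (A : finType) (X : set (config A))
    (phi : config A -> config A) (m n : nat)
    (f : (m + n).+1.-tuple A -> A) : Prop :=
  local_rule X f /\
  (forall a, X a -> forall j, phi a j = f (word a (j - m%:Z) (m + n).+1)).

Section Degrees.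
Variables (A : finType) (X : set (config A)) (N : nat).
Variable f : N.+1.-tuple A -> A.

Definition left_redundant (I : nat) : Prop :=
  forall a b, X a -> X b -> (forall j : int, 0 <= j -> a j = b j) ->
  f (word a (- I%:Z) N.+1) = f (word b (- I%:Z) N.+1).

Definition right_redundant (I : nat) : Prop :=
  forall a b, X a -> X b -> (forall j : int, j <= 0 -> a j = b j) ->
  f (word a (I%:Z - N%:Z) N.+1) = f (word b (I%:Z - N%:Z) N.+1).

Definition right_mergible (k : nat) : Prop :=
  forall a b, X a -> X b -> (forall j : int, j <= 0 -> a j = b j) ->
  (forall j : int, 1 <= j <= k%:Z + 1 ->
     f (word a (j - N%:Z) N.+1) = f (word b (j - N%:Z) N.+1)) ->
  a 1 = b 1.

Definition left_mergible (k : nat) : Prop :=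
  forall a b, X a -> X b -> (forall j : int, 0 <= j -> a j = b j) ->
  (forall j : int, 1 <= j <= k%:Z + 1 ->
     f (word a (- j) N.+1) = f (word b (- j) N.+1)) ->
  a (- 1) = b (- 1).

End Degrees.

(* Degrees are natural numbers or infinity; None stands for infinity. *)
Definition strictly_redundant (D : nat -> Prop) (I : option nat) : Prop :=
  if I is Some i then D i /\ ~ D i.+1 else forall i, D i.

Definition strictly_mergible (D : nat -> Prop) (k : option nat) : Prop :=
  if k is Some i then D i /\ (forall i', D i' -> (i <= i')%N)
  else forall i, ~ D i.

Section Limits.
Variable R : realType.
Local Open Scope ereal_scope.

Definition degree (d : option nat) : \bar R :=
  if d is Some i then (i%:R)%:E else +oo.

Variables (A : finType) (X : set (config A)) (phi : config A -> config A).

(* For an endomorphism phi, each of the sets of values below is a singleton,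
   since the value depends neither on m, n nor on the local rule f; the default
   0 of xget is then not used. *)
Definition P_L : \bar R :=
  xget 0 [set p | exists m n (f : (m + n).+1.-tuple A -> A) I,
    [/\ of_type X phi f, strictly_redundant (left_redundant X f) I &
        p = degree I - (m%:R)%:E]].

Definition P_R : \bar R :=
  xget 0 [set p | exists m n (f : (m + n).+1.-tuple A -> A) J,
    [/\ of_type X phi f, strictly_redundant (right_redundant X f) J &
        p = degree J - (n%:R)%:E]].

Definition Q_R : \bar R :=
  if `[< finite_set X >] then +oo else
  xget 0 [set q | exists m n (f : (m + n).+1.-tuple A -> A) k,
    [/\ of_type X phi f, strictly_mergible (right_mergible X f) k &
        q = (n%:R)%:E - degree k]].

Definition Q_L : \bar R :=
  if `[< finite_set X >] then +oo else
  xget 0 [set q | exists m n (f : (m + n).+1.-tuple A -> A) l,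
    [/\ of_type X phi f, strictly_mergible (left_mergible X f) l &
        q = (m%:R)%:E - degree l]].

End Limits.

(* The term s = 0, where the division is meaningless, does not affect the
   limit. *)
Section Averages.
Variables (R : realType) (A : finType) (X : set (config A)).
Variable phi : config A -> config A.
Local Open Scope ereal_scope.

Definition p_L : \bar R :=
  lim ((fun s : nat => P_L R X (iter s phi) * (s%:R^-1)%:E) @ \oo).

Definition p_R : \bar R :=
  lim ((fun s : nat => P_R R X (iter s phi) * (s%:R^-1)%:E) @ \oo).

Definition q_R : \bar R :=
  lim ((fun s : nat => Q_R R X (iter s phi) * (s%:R^-1)%:E) @ \oo).

Definition q_L : \bar R :=
  lim ((fun s : nat => Q_L R X (iter s phi) * (s%:R^-1)%:E) @ \oo).

End Averages.

(* Main.v *)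
Require Import Defs.
From HB Require Import structures.
From mathcomp Require Import all_boot all_order all_algebra.
From mathcomp Require Import all_classical all_reals all_analysis.
From mathcomp Require Import zify.

Set Implicit Arguments.
Unset Strict Implicit.
Unset Printing Implicit Defensive.

Import Order.TTheory GRing.Theory Num.Theory.
Import numFieldNormedType.Exports.
Local Open Scope classical_set_scope.
Local Open Scope ring_scope.

Local Notation shift := Defs.shift.

(** The degrees of an endomorphism have an intrinsic form, free of local rules.
    Write [redundant_at p] for the property that the image of a point at [p]
    depends only on the half-line of that point up to 0, and [mergible_at q] for
    the property that a point is determined at 1 by its half-line up to 0
    together with the half-line of its image up to [1 - q]. Both properties are
    inherited by smaller integers, and P_R and Q_R are the suprema of the
    integers that have them ([P_R_cut], [Q_R_cut]); P_L and Q_L are the same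
    for the reversed axis. For Q_R and Q_L this uses that [X] is infinite:
    otherwise the half-lines might determine the next coordinate by themselves,
    and the supremum would exceed every value that a type allows
    ([deterministic_finite]).

    By compactness, continuous maps commuting with the shift are block maps
    ([continuous_block_map]). A conjugacy and its inverse thus have a common
    radius r, and applying either of them to two points that agree on a
    half-line loses at most r coordinates. Carrying redundancy or mergibility
    through the conjugacy therefore costs 2 r ([redundant_at_conj],
    [mergible_at_conj]), and the degrees of conjugate endomorphisms differ by at
    most 2 r ([degrees_conj_le]). The same map conjugates the iterates of phi
    and psi, with the same r for all of them. After division by s the
    difference tends to 0, so the two sequences of averages have the same limits
    ([lim_average_eq]). *)

(** * Words, translates and half-lines *)

Definition translate (A : finType) (i : int) (a : config A) : config A :=
  fun j => a (j + i).

(** The coordinate axis read from left to right ([true]) or from right to left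
    ([false]); it turns the left and the right notions into one. *)
Definition along (e : bool) (j : int) : int := if e then j else - j.

Definition agree (A : finType) (e : bool) (c : int) (a b : config A) : Prop :=
  forall j, j <= c -> a (along e j) = b (along e j).

Lemma word_eq (A : finType) (a b : config A) (i i' : int) (k : nat) :
  word a i k = word b i' k <->
  forall t : nat, (t < k)%N -> a (i + t%:Z) = b (i' + t%:Z).
Proof.
split=> [h t tk|h].
  by have := congr1 (fun w => tnth w (Ordinal tk)) h; rewrite !tnth_mktuple.
by apply: eq_from_tnth => t; rewrite !tnth_mktuple h.
Qed.

Lemma agreeW (A : finType) e (c d : int) (a b : config A) :
  d <= c -> agree e c a b -> agree e d a b.
Proof. by move=> dc ab j jd; apply: ab; apply: le_trans jd dc. Qed.

Lemma agree_translate (A : finType) e (c i : int) (a b : config A) :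
  agree e c a b ->
  agree e (c - i) (translate (along e i) a) (translate (along e i) b).
Proof.
move=> ab j jc; have := ab (j + i); rewrite /translate /along.
by case: (e) => [-> //|]; [lia | rewrite opprD => -> //; lia].
Qed.

Lemma translate_translate (A : finType) i j (a : config A) :
  translate i (translate j a) = translate (i + j) a.
Proof. by apply: funext => k; rewrite /translate addrA. Qed.

Lemma translate0 (A : finType) (a : config A) : translate 0 a = a.
Proof. by apply: funext => k; rewrite /translate addr0. Qed.

Section Subshift.
Variables (A : finType) (X : set (config A)).
Hypothesis hX : subshift X.

Lemma translate_subshift i a : X a -> X (translate i a).
Proof.
have sX b : X b -> X (shift b) by case: hX => _ {2}<- Xb; exists b.
have sV b : X b -> X (translate (-1) b).
  case: hX => _ {1}<- [c Xc <-].
  by suff -> : translate (-1) (shift c) = c by []; apply: funext => j;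
     rewrite /translate /shift subrK.
elim/int_rect: i a => [|n IH|n IH] a Xa.
- by rewrite translate0.
- suff -> : translate n.+1 a = shift (translate n a) by exact/sX/IH.
  by apply: funext => j; rewrite /translate /shift -addrA -intS.
- suff -> : translate (- n.+1%:Z) a = translate (-1) (translate (- n%:Z) a).
    exact/sV/IH.
  by rewrite translate_translate intS opprD.
Qed.

Lemma translate_commute (B : finType) (theta : config A -> config B) :
  (forall a, X a -> theta (shift a) = shift (theta a)) ->
  forall i a, X a -> theta (translate i a) = translate i (theta a).
Proof.
move=> comm.
have one a : X a -> theta (translate 1 a) = translate 1 (theta a) by exact: comm.
elim/int_rect => [|n IH|n IH] a Xa.
- by rewrite !translate0.
- by rewrite !intS -!translate_translate one ?IH//; exact: translate_subshift.
- have Xb := translate_subshift (- n.+1%:Z) Xa.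
  have := congr1 (translate (-1)) (one _ Xb).
  rewrite !translate_translate addNr translate0.
  have -> : 1 - n.+1%:Z = - n%:Z by lia.
  rewrite IH// translate_translate => <-.
  by rewrite intS opprD.
Qed.

(** * Compactness of subshifts *)

Lemma subshift_compact : compact X.
Proof.
case: hX => clX _; apply: (subclosed_compact clX _ (fun=> fun=> I)).
have := @tychonoff int (fun=> discrete_topology A) (fun=> setT)
  (fun=> @finite_compact (discrete_topology A) setT finite_finset).
by congr compact; apply/seteqP; split.
Qed.

Lemma near_coordinate (x : config A) (j : int) :
  \forall a \near x, a j = x j.
Proof.
have := @proj_continuous int (fun=> discrete_topology A) j x.
by move=> /(_ [set y | y = x j]); apply; exact: discrete_set1.
Qed.

(** Compactness is applied to the pairs of points of [X]: a pair that differs at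
    a coordinate of [J] has neighbours that differ there, and near the other
    pairs [c] takes the same value on both components. With [J] everything this
    gives block maps, with [J] a half-line it bounds how far back a deterministic
    subshift must look. *)
Lemma finite_dependence (B : Type) (c : config A -> B) (J : set int) :
  (forall x, X x -> \forall a \near x, X a -> c a = c x) ->
  (forall a b, X a -> X b -> (forall j, J j -> a j = b j) -> c a = c b) ->
  exists r : nat, forall a b, X a -> X b ->
    (forall j, J j -> - r%:Z <= j <= r%:Z -> a j = b j) -> c a = c b.
Proof.
move=> loc det.
pose P (r : nat) (ab : config A * config A) :=
  (forall j, J j -> - r%:Z <= j <= r%:Z -> ab.1 j = ab.2 j) -> c ab.1 = c ab.2.
have /compact_near_coveringP/near_covering_withinP cov :=
  compact_setX subshift_compact subshift_compact.
have [|N _ HN] := cov nat \oo P _; last first.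
  exists N => a b Xa Xb ab.
  by apply: (HN N _ (a, b)) => //=.
move=> [x y] [/= Xx Xy].
have [xy|/existsNP[j /not_implyP[Jj xyj]]] :=
    pselect (forall j, J j -> x j = y j).
  have near_x : \forall ab \near (x, y) & r \near \oo,
      X ab.1 -> X ab.2 -> c ab.1 = c ab.2.
    exists ([set ab | (X ab.1 -> c ab.1 = c x) /\ (X ab.2 -> c ab.2 = c y)],
      setT) => [|[[a b] r] /= [[ax by_] _] Xa Xb]; last first.
      by rewrite ax// by_//; apply: det.
    split; last exact: filterT.
    by exists ([set a | X a -> c a = c x], [set b | X b -> c b = c y]);
      [split; exact: loc | move=> [a b] []].
  by apply: filterS near_x => -[[a b] r] /= h [Xa Xb] _; exact: h.
exists ([set ab | ab.1 j = x j /\ ab.2 j = y j], [set r | (`|j| <= r)%N]).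
  split; last exact: nbhs_infty_ge.
  by exists ([set a | a j = x j], [set b | b j = y j]);
    [split; exact: near_coordinate | move=> [a b] []].
move=> [[a b] r] /= [[ax by_] jr] _ abr; case: xyj.
by rewrite -ax -by_; apply: abr => //; lia.
Qed.

(** Where the left half-line of every point determines the next coordinate, by
    compactness a window of fixed length already determines it. Moving the
    window by one place is then a surjection of the finite set of windows onto
    itself, hence a bijection, so that a window determines the whole point. *)
Lemma deterministic_finite (e : bool) :
  (forall a b, X a -> X b -> agree e 0 a b ->
     a (along e 1) = b (along e 1)) ->
  finite_set X.
Proof.
move=> det.
have [|a b Xa Xb ab|r dep] := @finite_dependence A
    (fun a => a (along e 1)) [set j | exists2 i, i <= 0 & j = along e i].
- move=> x Xx; have := near_coordinate x (along e 1).
  by apply: (@filterS _ _ (nbhs_filter x)) => a ax _.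
- by apply: det => // j j0; apply: ab; exists j.
have next a b : X a -> X b ->
    (forall j, - r%:Z <= j <= 0 -> a (along e j) = b (along e j)) ->
    a (along e 1) = b (along e 1).
  move=> Xa Xb ab; apply: dep => // _ [j j0 ->] jr; apply: ab; rewrite j0.
  by move: jr; rewrite /along; case: (e); lia.
pose W (i : int) (a : config A) : {ffun 'I_r.+1 -> A} :=
  [ffun t : 'I_r.+1 => (a (along e (i - t%:Z)) : A)].
have WE i a b : W i a = W i b <->
    forall j, i - r%:Z <= j <= i -> a (along e j) = b (along e j).
  split=> [h j jr|h].
    have tr : (`|i - j| < r.+1)%N by lia.
    have /= := congr1 (fun w : {ffun 'I_r.+1 -> A} => w (Ordinal tr)) h.
    by rewrite !ffunE /=; have -> : i - `|i - j|%N%:Z = j by lia.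
  by apply/ffunP => t; rewrite !ffunE; apply: h; have := ltn_ord t; lia.
have Wtr i k a : W i (translate (along e k) a) = W (i + k) a.
  apply/ffunP => t; rewrite !ffunE /translate; congr a.
  by rewrite /along; case: (e); lia.
have Wnext a b : X a -> X b -> W 0 a = W 0 b -> W 1 a = W 1 b.
  move=> Xa Xb /WE ab; apply/WE => j jr.
  have [j0|j1] : j <= 0 \/ j = 1 by lia.
    by apply: ab; lia.
  by rewrite j1; apply: next => // k kr; apply: ab; lia.
(* [S] is the set of windows and [T] moves a window of [X] by one place. *)
pose S := [set w | `[< exists2 a, X a & W 0 a = w >]]%SET.
pose T w := if pselect (exists2 a, X a & W 0 a = w) is left h
            then W 1 (s2val (cid2 h)) else w.
have SW i a : X a -> W i a \in S.
  move=> Xa; rewrite inE; apply/asboolP.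
  exists (translate (along e i) a); first exact: translate_subshift.
  by rewrite Wtr add0r.
have TW a : X a -> T (W 0 a) = W 1 a.
  move=> Xa; rewrite /T; case: pselect => [h|[]]; last by exists a.
  by case: (cid2 h) => b Xb /= Wb; apply: Wnext.
have TS : [set T w | w in S]%SET = S.
  apply/setP/subset_eqP/andP; split; apply/fintype.subsetP => w.
    move=> /imsetP[v]; rewrite inE => /asboolP[a Xa <-] ->.
    by rewrite TW//; exact: SW.
  rewrite inE => /asboolP[a Xa <-]; apply/imsetP.
  exists (W (-1) a); first exact: SW.
  have Xb := translate_subshift (along e (-1)) Xa.
  have := TW _ Xb; rewrite !Wtr add0r => ->.
  by congr (W _ a).
have Tinj : {in S &, injective T} by apply/imset_injP; rewrite TS.
have Wback a b : X a -> X b -> W 0 a = W 0 b ->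
    forall n : nat, W (- n%:Z) a = W (- n%:Z) b.
  move=> Xa Xb ab; elim=> [//|n IH]; apply: Tinj; try exact: SW.
  have Xa' := translate_subshift (along e (- n.+1%:Z)) Xa.
  have Xb' := translate_subshift (along e (- n.+1%:Z)) Xb.
  have := TW _ Xa'; have := TW _ Xb'; rewrite !Wtr add0r => -> ->.
  by have -> : 1 + - n.+1%:Z = - n%:Z by lia.
have Wforth a b : X a -> X b -> W 0 a = W 0 b ->
    forall n : nat, W n a = W n b.
  move=> Xa Xb ab; elim=> [//|n IH].
  have Xa' := translate_subshift (along e n) Xa.
  have Xb' := translate_subshift (along e n) Xb.
  have := Wnext _ _ Xa' Xb'; rewrite !Wtr add0r => /(_ IH).
  by rewrite -intS.
have W0inj : {in X &, injective (W 0)}.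
  move=> a b /set_mem Xa /set_mem Xb ab; apply: funext => j.
  have aj : j = along e (along e j) by rewrite /along; case: (e); lia.
  rewrite aj; move: (along e j) => {aj}j; case: (intP j) => [|n|n].
  - by have /WE := ab; apply; lia.
  - by have /WE := Wforth _ _ Xa Xb ab n.+1; apply; lia.
  - by have /WE := Wback _ _ Xa Xb ab n.+1; apply; lia.
have : finite_set (W 0 @` X) := finite_finset.
by rewrite (eq_finite_set (inj_card_eq W0inj)).
Qed.

End Subshift.

(** * Block maps *)

Definition block_map (A B : finType) (X : set (config A)) (Y : set (config B))
    (r : nat) (theta : config A -> config B) : Prop :=
  [/\ set_fun X Y theta,
      forall a, X a -> theta (shift a) = shift (theta a) &
      forall a b, X a -> X b -> forall i,
        (forall j, i - r%:Z <= j <= i + r%:Z -> a j = b j) ->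
        theta a i = theta b i].

(** The Curtis-Hedlund-Lyndon theorem: a single coordinate of [theta a] is a
    locally constant observable, so compactness bounds the window on which it
    depends, and commutation with the shift makes the bound uniform. *)
Lemma continuous_block_map (A B : finType) (X : set (config A))
    (Y : set (config B)) (theta : config A -> config B) :
  subshift X -> set_fun X Y theta -> {within X, continuous theta} ->
  (forall a, X a -> theta (shift a) = shift (theta a)) ->
  exists r, block_map X Y r theta.
Proof.
move=> hX fXY /subspace_continuousP cont comm.
have [x Xx|a b Xa Xb ab|r dep] :=
    @finite_dependence A X hX _ (fun a => theta a 0) setT.
- exact: cont Xx _ (near_coordinate (theta x) 0).
- by congr (theta _ _); apply: funext => j; exact: ab.
exists r; split=> // a b Xa Xb i ab.
have at0 c : X c -> theta c i = theta (translate i c) 0.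
  by move=> Xc; rewrite (translate_commute hX comm)// /translate add0r.
rewrite !at0//; apply: dep; try exact: translate_subshift.
by move=> j _ jr; apply: ab; lia.
Qed.

Lemma block_map_iter (A : finType) (X : set (config A)) (r : nat)
    (phi : config A -> config A) (s : nat) :
  block_map X X r phi -> block_map X X (s * r) (iter s phi).
Proof.
move=> [fX comm loc]; elim: s => [|s [IHf IHc IHl]].
  by split=> // a b _ _ i ab; apply: ab; lia.
split=> /= [a Xa|a Xa|a b Xa Xb i ab]; first exact/fX/IHf.
  by rewrite IHc// comm//; exact: IHf.
apply: loc; try exact: IHf.
by move=> j jr; apply: IHl => // k kr; apply: ab; lia.
Qed.

Lemma block_map_agree (A B : finType) (X : set (config A)) (Y : set (config B))
    (r : nat) (theta : config A -> config B) e c a b :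
  block_map X Y r theta -> X a -> X b -> agree e c a b ->
  agree e (c - r%:Z) (theta a) (theta b).
Proof.
move=> [_ _ loc] Xa Xb ab j jc; apply: loc => // k kr.
have -> : k = along e (along e k) by rewrite /along; case: (e); lia.
by apply: ab; move: kr jc; rewrite /along; case: (e); lia.
Qed.

(** A block map of radius [r] is of type (r, r): the local rule evaluates the
    map on any point of [X] that shows the given word around 0. *)
Lemma of_type_exists (A : finType) (a0 : A) (X : set (config A)) (r : nat)
    (phi : config A -> config A) :
  subshift X -> block_map X X r phi ->
  exists m n (f : (m + n).+1.-tuple A -> A), of_type X phi f.
Proof.
move=> hX [fX comm loc].
pose f (w : (r + r).+1.-tuple A) : A :=
  if pselect (exists2 a, X a & word a (- r%:Z) (r + r).+1 = w) is left h
  then phi (s2val (cid2 h)) 0 else a0.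
have fE a i : X a -> f (word a i (r + r).+1) = phi a (i + r%:Z).
  move=> Xa; have Xb := translate_subshift hX (i + r%:Z) Xa.
  have -> : phi a (i + r%:Z) = phi (translate (i + r%:Z) a) 0.
    by rewrite (translate_commute hX comm)// /translate add0r.
  rewrite /f; case: pselect => [h|[]]; last first.
    exists (translate (i + r%:Z) a) => //; apply/word_eq => t _.
    by rewrite /translate; congr a; lia.
  case: (cid2 h) => b Xb' /= /word_eq ba; apply: loc => //.
  suff bj (j : int) : - r%:Z <= j <= r%:Z -> b j = translate (i + r%:Z) a j.
    by move=> j jr; apply: bj; lia.
  move=> jr; have tr : (`|(j + r%:Z)%R| < (r + r).+1)%N by lia.
  have := ba _ tr; have -> : - r%:Z + `|(j + r%:Z)%R|%N%:Z = j by lia.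
  by move=> ->; rewrite /translate; congr a; lia.
exists r, r, f; split=> [|a Xa j]; last by rewrite fE// subrK.
split=> [_ [a Xa [i ->]]|a Xa].
  exists (phi a); first exact: fX.
  exists (i + r%:Z); rewrite fE//; apply: eq_from_tnth => t.
  by rewrite tnth_mktuple (ord1 t) tnth0 addr0.
have -> : (fun j => f (word a j (r + r).+1)) = translate r (phi a).
  by apply: funext => j; rewrite fE.
exact/(translate_subshift hX)/fX.
Qed.

(** * Redundancy and mergibility as cuts of the integers *)

Section Cuts.
Variable R : realType.

(** [v] is the supremum in the extended line of the set [E] of integers, which
    is meant to be closed downwards. *)
Definition cut (E : int -> Prop) (v : \bar R) : Prop :=
  match v with
  | +oo%E => forall p, E p
  | -oo%E => forall p, ~ E p
  | x%:E => exists p : int, [/\ E p, ~ E (p + 1) & x = p%:~R]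
  end.

Definition down_closed (E : int -> Prop) : Prop :=
  forall p q : int, q <= p -> E p -> E q.

Lemma strictly_redundant_exists (D : nat -> Prop) :
  D 0%N -> exists I, strictly_redundant D I.
Proof.
move=> D0; have [all|/existsNP[i Di]] := pselect (forall i, D i).
  by exists None.
suff [k [Dk Dk1]] : exists k, D k /\ ~ D k.+1 by exists (Some k).
apply: contrapT => none; apply: Di; elim: i => [//|i Di].
by apply: contrapT => Di1; apply: none; exists i.
Qed.

Lemma strictly_mergible_exists (D : nat -> Prop) :
  exists k, strictly_mergible D k.
Proof.
have [[i Di]|none] := pselect (exists i, D i); last first.
  by exists None => i Di; apply: none; exists i.
have ex : exists i, `[< D i >] by exists i; exact/asboolP.
case: (ex_minnP ex) => k /asboolP Dk kmin.
by exists (Some k); split=> // j Dj; apply/kmin/asboolP.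
Qed.

(** The degrees [P_L] and [P_R] are normalized so that they no longer depend on
    the type: they are suprema of sets of integers attached to the map. *)
Lemma cut_redundant (D : nat -> Prop) (E : int -> Prop) (n : nat) I :
  (forall i : nat, D i <-> E (i%:Z - n%:Z)) -> down_closed E ->
  strictly_redundant D I -> cut E (degree R I - (n%:R)%:E)%E.
Proof.
move=> DE dE; case: I => [i [Di Di1]|all] /=.
  exists (i%:Z - n%:Z); split; first exact/DE.
    by move=> Ei; apply/Di1/DE; move: Ei; congr E; lia.
  by rewrite intrB.
move=> p; apply: (dE (`|(p + n%:Z)%R|%N%:Z - n%:Z)); first by lia.
exact/DE.
Qed.

(** A local rule only probes the integers up to [n], hence the hypothesis that
    [n + 1] lies outside of [E]. *)
Lemma cut_mergible (D : nat -> Prop) (E : int -> Prop) (n : nat) k :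
  (forall i : nat, D i <-> E (n%:Z - i%:Z)) -> down_closed E ->
  ~ E (n%:Z + 1) -> strictly_mergible D k -> cut E ((n%:R)%:E - degree R k)%E.
Proof.
move=> DE dE En; case: k => [k [Dk kmin]|none] /=.
  exists (n%:Z - k%:Z); split; first exact/DE.
    case: k Dk kmin => [|k] Dk kmin Ek.
      by apply: En; move: Ek; rewrite subr0.
    have /kmin : D k by apply/DE; move: Ek; congr E; lia.
    by rewrite ltnn.
  by rewrite intrB.
move=> p Ep; apply: (none `|n%:Z - p|%N); apply/DE.
by apply: dE Ep; lia.
Qed.

Lemma cut_le (E E' : int -> Prop) (v v' : \bar R) (c : nat) :
  down_closed E' -> cut E v -> cut E' v' ->
  (forall p, E p -> E' (p - c%:Z)) -> (v - (c%:R)%:E <= v')%E.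
Proof.
move=> dE' + + EE'; case: v => [x [p [Ep Ep1 ->]]|all|_ _]; last exact: leNye.
- case: v' => [y [q [Eq Eq1 ->]]|_|none]; last by case: (none _ (EE' _ Ep)).
    rewrite -EFinB lee_fin -[c%:R]/(c%:~R) -intrB ler_int leNgt.
    by apply/negP => qp; apply: Eq1; apply: dE' (EE' _ Ep); lia.
  by rewrite leey.
- case: v' => [y [q [Eq Eq1 ->]]|_|none]; last by case: (none _ (EE' _ (all 0))).
    by case: Eq1; have := EE' _ (all (q + 1 + c%:Z)); rewrite addrK.
  by rewrite leey.
Qed.

(** Sequences at bounded distance have the same averages up to a term that
    tends to 0, so their averages have the same limits, and [lim] depends only
    on the set of limits. *)
Lemma lim_average_eq (u v : nat -> \bar R) (c : nat) :
  (forall s, u s - (c%:R)%:E <= v s)%E ->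
  (forall s, v s - (c%:R)%:E <= u s)%E ->
  lim ((fun s : nat => u s * (s%:R^-1)%:E)%E @ \oo) =
  lim ((fun s : nat => v s * (s%:R^-1)%:E)%E @ \oo).
Proof.
move=> uv vu.
have inv0 : ((c%:R * s%:R^-1)%:E : \bar R) @[s --> \oo] --> (0 : R)%:E.
  apply: cvg_EFin; first exact: nearW.
  rewrite -(mulr0 c%:R); apply: cvgMl_tmp.
  rewrite -(@cvg_shiftS R (fun s : nat => s%:R^-1)).
  exact: cvg_harmonic.
have half (u' v' : nat -> \bar R) (l : \bar R) :
    (forall s, u' s - (c%:R)%:E <= v' s)%E ->
    (forall s, v' s - (c%:R)%:E <= u' s)%E ->
    (u' s * (s%:R^-1)%:E)%E @[s --> \oo] --> l ->
    (v' s * (s%:R^-1)%:E)%E @[s --> \oo] --> l.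
  move=> uv' vu' ul.
  apply: (@squeeze_cvge _ _ _ _
    (fun s => u' s * (s%:R^-1)%:E - (c%:R * s%:R^-1)%:E)%E _
    (fun s => u' s * (s%:R^-1)%:E + (c%:R * s%:R^-1)%:E)%E).
  - apply: nearW => s.
    have s0 : (0 <= (s%:R^-1)%:E :> \bar R)%E by rewrite lee_fin.
    apply/andP; split.
      rewrite EFinM -muleBl//; first exact: lee_wpmul2r.
      exact: fin_num_adde_defl.
    rewrite EFinM -muleDl//; last exact: fin_num_adde_defl.
    apply: lee_wpmul2r => //.
    by rewrite -leeBlDr.
  - by rewrite -[l]sube0; apply: (cvgeB _ ul inv0); exact: fin_num_adde_defl.
  - by rewrite -[l]adde0; apply: (cvgeD _ ul inv0); exact: fin_num_adde_defl.
congr (get _); apply/funext => l; apply/propext.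
by split; exact: half.
Qed.

End Cuts.

(** * Intrinsic form of the degrees *)

Section Intrinsic.
Variables (A : finType) (X : set (config A)) (phi : config A -> config A).
Variable e : bool.

(** With a local rule of type (m, n) this is right redundancy of degree [p + n],
    or left redundancy of degree [p + m] for [e = false]. *)
Definition redundant_at (p : int) : Prop :=
  forall a b, X a -> X b -> agree e 0 a b -> phi a (along e p) = phi b (along e p).

(** With a local rule of type (m, n) this is right mergibility of degree
    [n - q], or left mergibility of degree [m - q] for [e = false]. *)
Definition mergible_at (q : int) : Prop :=
  forall a b, X a -> X b -> agree e 0 a b -> agree e (1 - q) (phi a) (phi b) ->
  a (along e 1) = b (along e 1).

Lemma mergible_at_down : down_closed mergible_at.
Proof.
move=> p q qp Mp a b Xa Xb ab phiab; apply: Mp => //.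
by apply: agreeW phiab; lia.
Qed.

Variable r : nat.
Hypotheses (hX : subshift X) (hphi : block_map X X r phi).

Let phi_translate i a : X a -> phi (translate i a) = translate i (phi a).
Proof. by case: hphi => _ comm _; exact: translate_commute. Qed.

Lemma redundant_at_down : down_closed redundant_at.
Proof.
move=> p q qp Rp a b Xa Xb ab.
have Xa' := translate_subshift hX (along e (q - p)) Xa.
have Xb' := translate_subshift hX (along e (q - p)) Xb.
have pq : along e p + along e (q - p) = along e q.
  by rewrite /along; case: (e); lia.
suff /(Rp _ _ Xa' Xb') : agree e 0 (translate (along e (q - p)) a)
                                   (translate (along e (q - p)) b).
  by rewrite !phi_translate// /translate pq.
by apply: agreeW (agree_translate (i := q - p) ab); lia.
Qed.

(** Commutation with the shift moves the half-line from 0 to [i], and the lower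
    closure gives all the coordinates of the image up to [i + p]. *)
Lemma redundant_at_agree p i a b : redundant_at p -> X a -> X b ->
  agree e i a b -> agree e (i + p) (phi a) (phi b).
Proof.
move=> Rp Xa Xb ab j jp.
have Xa' := translate_subshift hX (along e i) Xa.
have Xb' := translate_subshift hX (along e i) Xb.
have Rj : redundant_at (j - i) by apply: redundant_at_down Rp; lia.
have ji : along e (j - i) + along e i = along e j.
  by rewrite /along; case: (e); lia.
suff /(Rj _ _ Xa' Xb') : agree e 0 (translate (along e i) a)
                                   (translate (along e i) b).
  by rewrite !phi_translate// /translate ji.
by apply: agreeW (agree_translate (i := i) ab); lia.
Qed.

(** Mergibility is used again and again: each time the agreement of the
    preimages extends by one more coordinate. *)
Lemma mergible_at_agree q i k a b : mergible_at q -> X a -> X b ->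
  agree e i a b -> agree e k (phi a) (phi b) -> agree e (k + q) a b.
Proof.
move=> Mq Xa Xb ab phiab.
suff ext (d : nat) : i + d%:Z <= k + q \/ d = 0%N -> agree e (i + d%:Z) a b.
  have [le|lt] := leP i (k + q).
    by apply: agreeW (ext `|(k + q - i)%R|%N _); lia.
  by apply: agreeW ab; lia.
elim: d => [|d IH] hd; first by rewrite addr0.
have {}IH : agree e (i + d%:Z) a b by apply: IH; lia.
move=> j; rewrite le_eqVlt => /orP[/eqP ->|lt]; last by apply: IH; lia.
have Xa' := translate_subshift hX (along e (i + d%:Z)) Xa.
have Xb' := translate_subshift hX (along e (i + d%:Z)) Xb.
have -> : along e (i + d.+1%:Z) = along e 1 + along e (i + d%:Z).
  by rewrite /along; case: (e); lia.
apply: (Mq _ _ Xa' Xb').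
  by apply: agreeW (agree_translate (i := i + d%:Z) IH); lia.
rewrite !phi_translate//.
by apply: agreeW (agree_translate (i := i + d%:Z) phiab); lia.
Qed.

End Intrinsic.

Section OfType.
Variables (A : finType) (X : set (config A)) (phi : config A -> config A).
Variables (m n : nat) (f : (m + n).+1.-tuple A -> A).
Hypothesis hf : of_type X phi f.

Lemma of_typeE a i : X a -> f (word a i (m + n).+1) = phi a (i + m%:Z).
Proof. by move=> Xa; case: hf => _ -> //; rewrite addrK. Qed.

(** The part of the image that the type of the map alone controls. *)
Lemma of_type_agree (e : bool) a b : X a -> X b -> agree e 0 a b ->
  agree e (- (if e then n else m)%:Z) (phi a) (phi b).
Proof.
move=> Xa Xb ab j jn.
have E c : X c ->
    phi c (along e j) = f (word c (along e j - m%:Z) (m + n).+1).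
  by move=> Xc; rewrite of_typeE// subrK.
rewrite !E//; congr f; apply/word_eq => t tN.
have [k jk] : exists k, k = along e j - m%:Z + t%:Z by eexists.
rewrite -jk.
have -> : k = along e (along e k) by rewrite /along; case: (e); lia.
by apply: ab; move: jk jn; rewrite /along; case: (e) => /=; lia.
Qed.

Lemma right_redundantE (J : nat) :
  right_redundant X f J <-> redundant_at X phi true (J%:Z - n%:Z).
Proof.
have E : J%:Z - (m + n)%N%:Z + m%:Z = J%:Z - n%:Z by lia.
by split=> D a b Xa Xb ab; have := D a b Xa Xb ab; rewrite !of_typeE ?E.
Qed.

Lemma agree_false c (a b : config A) :
  agree false c a b <-> forall j, - c <= j -> a j = b j.
Proof.
split=> ab j jc; last by apply: ab; rewrite /along; lia.
by rewrite -(opprK j); apply: (ab (- j)); lia.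
Qed.

Lemma left_redundantE (I : nat) :
  left_redundant X f I <-> redundant_at X phi false (I%:Z - m%:Z).
Proof.
have E : - I%:Z + m%:Z = - (I%:Z - m%:Z) by lia.
split=> D a b Xa Xb ab; have := D a b Xa Xb; rewrite !of_typeE// E; apply.
  by move/agree_false: ab; rewrite oppr0.
by apply/agree_false; rewrite oppr0.
Qed.

Lemma right_mergibleE (k : nat) :
  right_mergible X f k <-> mergible_at X phi true (n%:Z - k%:Z).
Proof.
split=> D a b Xa Xb ab phiab; apply: (D a b Xa Xb ab).
  by move=> j jk; rewrite !of_typeE//; apply: phiab; lia.
move=> j jk; have [j1|j0] := leP 1 (j + n%:Z); last first.
  by apply: (@of_type_agree true a b Xa Xb ab); lia.
have := phiab (j + n%:Z); rewrite !of_typeE//.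
have -> : j + n%:Z - (m + n)%N%:Z + m%:Z = j by lia.
by apply; lia.
Qed.

Lemma left_mergibleE (k : nat) :
  left_mergible X f k <-> mergible_at X phi false (m%:Z - k%:Z).
Proof.
split=> D a b Xa Xb ab phiab; apply: (D a b Xa Xb).
- by move/agree_false: ab; rewrite oppr0.
- move=> j jk; rewrite !of_typeE//.
  have -> : - j + m%:Z = - (j - m%:Z) by lia.
  by apply: phiab; lia.
- by apply/agree_false; rewrite oppr0.
move=> j jk; have [j1|j0] := leP 1 (j + m%:Z); last first.
  apply: (@of_type_agree false a b Xa Xb _); last by lia.
  by apply/agree_false; rewrite oppr0.
have := phiab (j + m%:Z); rewrite !of_typeE//.
have -> : - (j + m%:Z) + m%:Z = - j by lia.
by apply; lia.
Qed.

(** One more than the largest degree allowed by the type is excluded: there the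
    condition on the images holds by itself, and [X] would be deterministic. *)
Lemma not_mergible_at (e : bool) : subshift X -> infinite_set X ->
  ~ mergible_at X phi e ((if e then n else m)%:Z + 1).
Proof.
move=> hX infX M; apply: infX; apply: (deterministic_finite hX (e := e)).
move=> a b Xa Xb ab; apply: M => //.
by apply: agreeW (of_type_agree Xa Xb ab); lia.
Qed.

End OfType.

Section Values.
Variables (R : realType) (A : finType) (a0 : A) (X : set (config A)).
Variables (phi : config A -> config A) (r : nat).
Hypotheses (hX : subshift X) (hphi : block_map X X r phi).

Lemma P_R_cut : cut (redundant_at X phi true) (P_R R X phi).
Proof.
rewrite /P_R; set P := (X in xget _ X).
have [m [n [f hf]]] := of_type_exists a0 hX hphi.
suff /(xgetPex 0%E) [m' [n' [f' [J [hf' DJ ->]]]]] : exists p, P p.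
  apply: cut_redundant DJ; first exact: right_redundantE hf'.
  exact: redundant_at_down hX hphi.
have [J DJ] : exists J, strictly_redundant (right_redundant X f) J.
  apply: strictly_redundant_exists; apply/(right_redundantE hf) => a b Xa Xb ab.
  by apply: (of_type_agree hf (e := true)) => //; lia.
by exists (degree R J - n%:R%:E)%E, m, n, f, J.
Qed.

Lemma P_L_cut : cut (redundant_at X phi false) (P_L R X phi).
Proof.
rewrite /P_L; set P := (X in xget _ X).
have [m [n [f hf]]] := of_type_exists a0 hX hphi.
suff /(xgetPex 0%E) [m' [n' [f' [I [hf' DI ->]]]]] : exists p, P p.
  apply: cut_redundant DI; first exact: left_redundantE hf'.
  exact: redundant_at_down hX hphi.
have [I DI] : exists I, strictly_redundant (left_redundant X f) I.
  apply: strictly_redundant_exists; apply/(left_redundantE hf) => a b Xa Xb ab.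
  by apply: (of_type_agree hf (e := false)) => //; lia.
by exists (degree R I - m%:R%:E)%E, m, n, f, I.
Qed.

Hypothesis infX : infinite_set X.

Lemma Q_R_cut : cut (mergible_at X phi true) (Q_R R X phi).
Proof.
rewrite /Q_R; case: asboolP => // _; set P := (X in xget _ X).
have [m [n [f hf]]] := of_type_exists a0 hX hphi.
suff /(xgetPex 0%E) [m' [n' [f' [k [hf' Dk ->]]]]] : exists q, P q.
  apply: cut_mergible Dk; first exact: right_mergibleE hf'.
    exact: mergible_at_down.
  exact: (not_mergible_at hf' (e := true)).
have [k Dk] := strictly_mergible_exists (right_mergible X f).
by exists (n%:R%:E - degree R k)%E, m, n, f, k.
Qed.

Lemma Q_L_cut : cut (mergible_at X phi false) (Q_L R X phi).
Proof.
rewrite /Q_L; case: asboolP => // _; set P := (X in xget _ X).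
have [m [n [f hf]]] := of_type_exists a0 hX hphi.
suff /(xgetPex 0%E) [m' [n' [f' [k [hf' Dk ->]]]]] : exists q, P q.
  apply: cut_mergible Dk; first exact: left_mergibleE hf'.
    exact: mergible_at_down.
  exact: (not_mergible_at hf' (e := false)).
have [k Dk] := strictly_mergible_exists (left_mergible X f).
by exists (m%:R%:E - degree R k)%E, m, n, f, k.
Qed.

End Values.

(** * Conjugacy *)

Definition block_conjugacy (A B : finType) (X : set (config A))
    (Y : set (config B)) (r : nat) (theta : config A -> config B)
    (theta' : config B -> config A) : Prop :=
  [/\ block_map X Y r theta, block_map Y X r theta',
      forall a, X a -> theta' (theta a) = a &
      forall b, Y b -> theta (theta' b) = b].

Lemma block_conjugacy_sym (A B : finType) (X : set (config A))
    (Y : set (config B)) r theta theta' :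
  block_conjugacy X Y r theta theta' -> block_conjugacy Y X r theta' theta.
Proof. by case. Qed.

Lemma intertwine_iter (A B : finType) (X : set (config A))
    (theta : config A -> config B) (phi : config A -> config A)
    (psi : config B -> config B) :
  set_fun X X phi -> (forall a, X a -> theta (phi a) = psi (theta a)) ->
  forall s a, X a -> theta (iter s phi a) = iter s psi (theta a).
Proof.
move=> fphi th s a Xa.
have fX t : X (iter t phi a) by elim: t => //= t; exact: fphi.
by elim: s => //= s <-; rewrite th.
Qed.

Section Conjugacy.
Variables (A B : finType) (X : set (config A)) (Y : set (config B)).
Variables (r : nat) (theta : config A -> config B) (theta' : config B -> config A).
Hypothesis hth : block_conjugacy X Y r theta theta'.

Lemma intertwine_inv (phi : config A -> config A) (psi : config B -> config B) :
  set_fun X X phi -> (forall a, X a -> theta (phi a) = psi (theta a)) ->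
  forall b, Y b -> theta' (psi b) = phi (theta' b).
Proof.
case: hth => _ [fYX _ _] K K' fphi th b Yb.
by rewrite -{1}(K' _ Yb) -th ?K//; [exact/fphi/fYX | exact: fYX].
Qed.

Variables (phi : config A -> config A) (psi : config B -> config B) (k : nat).
Hypotheses (hX : subshift X) (hphi : block_map X X k phi).
Hypothesis hpsi : set_fun Y Y psi.
Hypothesis th : forall a, X a -> theta (phi a) = psi (theta a).

(** Conjugating by block maps of radius [r] costs [r] coordinates on the way to
    [X] and [r] coordinates on the way back. *)
Lemma redundant_at_conj (e : bool) p :
  redundant_at X phi e p -> redundant_at Y psi e (p - (r + r)%:Z).
Proof.
have [fphi _ _] := hphi; have inv := intertwine_inv fphi th.
case: hth => bth bth' K K' Rp a b Ya Yb ab.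
have [fYX _ _] := bth'.
have E c : Y c -> psi c = theta (phi (theta' c)).
  by move=> Yc; rewrite -inv// K'//; exact: hpsi.
rewrite !E//.
have := redundant_at_agree hX hphi Rp (fYX _ Ya) (fYX _ Yb)
  (block_map_agree bth' Ya Yb ab).
move/(block_map_agree bth (fphi _ (fYX _ Ya)) (fphi _ (fYX _ Yb))).
by apply; lia.
Qed.

Lemma mergible_at_conj (e : bool) q :
  mergible_at X phi e q -> mergible_at Y psi e (q - (r + r)%:Z).
Proof.
have [fphi _ _] := hphi; have inv := intertwine_inv fphi th.
case: hth => bth bth' K K' Mq a b Ya Yb ab psiab.
have [fYX _ _] := bth'.
have := block_map_agree bth' (hpsi Ya) (hpsi Yb) psiab.
rewrite !inv// => phiab.
have := mergible_at_agree hX hphi Mq (fYX _ Ya) (fYX _ Yb)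
  (block_map_agree bth' Ya Yb ab) phiab.
move/(block_map_agree bth (fYX _ Ya) (fYX _ Yb)).
by rewrite !K'//; apply; lia.
Qed.

Hypothesis hY : subshift Y.

(** The degrees of conjugate endomorphisms differ by a bound that depends only
    on the conjugacy. *)
Lemma degrees_conj_le (R : realType) (a0 : A) (b0 : B) (l : nat) :
  block_map Y Y l psi ->
  let c := ((r + r)%:R%:E : \bar R)%E in
  [/\ (P_L R X phi - c <= P_L R Y psi)%E, (P_R R X phi - c <= P_R R Y psi)%E,
      (Q_L R X phi - c <= Q_L R Y psi)%E & (Q_R R X phi - c <= Q_R R Y psi)%E].
Proof.
move=> bpsi c.
have PL : (P_L R X phi - c <= P_L R Y psi)%E.
  apply: cut_le (P_L_cut R a0 hX hphi) (P_L_cut R b0 hY bpsi) _.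
    exact: redundant_at_down hY bpsi.
  exact: redundant_at_conj.
have PR : (P_R R X phi - c <= P_R R Y psi)%E.
  apply: cut_le (P_R_cut R a0 hX hphi) (P_R_cut R b0 hY bpsi) _.
    exact: redundant_at_down hY bpsi.
  exact: redundant_at_conj.
have [finY|infY] := pselect (finite_set Y).
  by split=> //; [rewrite {2}/Q_L | rewrite {2}/Q_R]; rewrite asboolT// leey.
have infX : infinite_set X.
  case: hth => _ [fYX _ _] _ K' /(finite_image theta) fin; apply: infY.
  apply: sub_finite_set fin => b Yb.
  by exists (theta' b); [exact: fYX | exact: K'].
split=> //.
- apply: cut_le (Q_L_cut R a0 hX hphi infX) (Q_L_cut R b0 hY bpsi infY) _.
    exact: mergible_at_down.
  exact: mergible_at_conj.
- apply: cut_le (Q_R_cut R a0 hX hphi infX) (Q_R_cut R b0 hY bpsi infY) _.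
    exact: mergible_at_down.
  exact: mergible_at_conj.
Qed.

End Conjugacy.

(** The Curtis-Hedlund-Lyndon theorem makes block maps of a topological
    conjugacy and of its inverse; the sum of their radii serves for both. *)
Lemma conjugate_block (A A' : finType) (X : set (config A))
    (X' : set (config A')) (phi : config A -> config A)
    (psi : config A' -> config A') :
  subshift X -> subshift X' -> top_conjugate X phi X' psi ->
  exists r theta theta', block_conjugacy X X' r theta theta' /\
    forall a, X a -> theta (phi a) = psi (theta a).
Proof.
move=> hX hX' [theta [[fth cth [theta' [fth' cth' K K']]] comm th]].
have {}K a : X a -> theta' (theta a) = a by move=> /mem_set; exact: K.
have {}K' a : X' a -> theta (theta' a) = a by move=> /mem_set; exact: K'.
have comm' b : X' b -> theta' (shift b) = shift (theta' b).
  move=> Xb; have Xa := fth' _ Xb.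
  by rewrite -{1}(K' _ Xb) -comm// K//; exact: (translate_subshift hX 1 Xa).
have [r [_ _ loc]] := continuous_block_map hX fth cth comm.
have [r' [_ _ loc']] := continuous_block_map hX' fth' cth' comm'.
exists (r + r')%N, theta, theta'; split=> //; split=> //; split=> // a b Xa Xb i ab.
  by apply: loc => // j jr; apply: ab; lia.
by apply: loc' => // j jr; apply: ab; lia.
Qed.

Theorem theorem9p4 (R : realType) (A A' : finType)
    (hA : (1 < #|A|)%N) (hA' : (1 < #|A'|)%N)
    (X : set (config A)) (X' : set (config A'))
    (hX : subshift X) (hX' : subshift X')
    (phi : config A -> config A) (psi : config A' -> config A')
    (hphi : endomorphism X phi) (hpsi : endomorphism X' psi)
    (hconj : top_conjugate X phi X' psi) :
  [/\ (- p_L R X phi = - p_L R X' psi)%E,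
      p_R R X phi = p_R R X' psi,
      (- q_R R X phi = - q_R R X' psi)%E &
      q_L R X phi = q_L R X' psi].
Proof.
have [a0 _] : exists a : A, a \in A by apply/card_gt0P; exact: ltnW.
have [a0' _] : exists a : A', a \in A' by apply/card_gt0P; exact: ltnW.
have [r [theta [theta' [hth th]]]] := conjugate_block hX hX' hconj.
case: hphi hpsi => [fphi cphi commphi] [fpsi cpsi commpsi].
have [k bphi] := continuous_block_map hX fphi cphi commphi.
have [k' bpsi] := continuous_block_map hX' fpsi cpsi commpsi.
have hth' := block_conjugacy_sym hth.
have th' := intertwine_inv hth fphi th.
have le s : _ := degrees_conj_le hth hX (block_map_iter s bphi)
  (let: And3 h _ _ := block_map_iter s bpsi in h)
  (intertwine_iter fphi th s) hX' R a0 a0' (block_map_iter s bpsi).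
have le' s : _ := degrees_conj_le hth' hX' (block_map_iter s bpsi)
  (let: And3 h _ _ := block_map_iter s bphi in h)
  (intertwine_iter fpsi th' s) hX R a0' a0 (block_map_iter s bphi).
have pL : p_L R X phi = p_L R X' psi.
  by apply: (@lim_average_eq R _ _ (r + r)) => s; [case: (le s)|case: (le' s)].
have pR : p_R R X phi = p_R R X' psi.
  by apply: (@lim_average_eq R _ _ (r + r)) => s; [case: (le s)|case: (le' s)].
have qR : q_R R X phi = q_R R X' psi.
  by apply: (@lim_average_eq R _ _ (r + r)) => s; [case: (le s)|case: (le' s)].
have qL : q_L R X phi = q_L R X' psi.
  by apply: (@lim_average_eq R _ _ (r + r)) => s; [case: (le s)|case: (le' s)].
by rewrite pL pR qR qL.
Qed.
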